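(* Let $\Phi$ be a root system with weight lattice $\Lambda$ and index set $I$ for the simple roots $(\alpha_i)_{i\in I}$, and let $\mathcal{Q}$ and $\mathcal{Q}'$ be seminormal quasi-crystals of type $\Phi$ with underlying sets $Q$ and $Q'$. Let $Q\ddot{\otimes}Q'$ be the Cartesian product $Q\times Q'$, whose elements are written $x\ddot{\otimes}x'$ ($x\in Q$, $x'\in Q'$). Define $\mathrm{wt}(x\ddot{\otimes}x')=\mathrm{wt}(x)+\mathrm{wt}(x')$, and for each $i\in I$ define $\ddot{e}_i,\ddot{f}_i:Q\ddot{\otimes}Q'\to (Q\ddot{\otimes}Q')\sqcup\{\bot\}$ and $\ddot{\varepsilon}_i,\ddot{\varphi}_i:Q\ddot{\otimes}Q'\to\mathbb{Z}\cup\{-\infty,+\infty\}$ as follows: (1) if $\ddot{\varphi}_i(x)>0$ and $\ddot{\varepsilon}_i(x')>0$, set $\ddot{e}_i(x\ddot{\otimes}x')=\ddot{f}_i(x\ddot{\otimes}x')=\bot$ and $\ddot{\varepsilon}_i(x\ddot{\otimes}x')=\ddot{\varphi}_i(x\ddot{\otimes}x')=+\infty$; (2) otherwise set $\ddot{e}_i(x\ddot{\otimes}x')=\ddot{e}_i(x)\ddot{\otimes}x'$ if $\ddot{\varphi}_i(x)\ge\ddot{\varepsilon}_i(x')$ and $=x\ddot{\otimes}\ddot{e}_i(x')$ if $\ddot{\varphi}_i(x)<\ddot{\varepsilon}_i(x')$; $\ddot{f}_i(x\ddot{\otimes}x')=\ddot{f}_i(x)\ddot{\otimes}x'$ if $\ddot{\varphi}_i(x)>\ddot{\varepsilon}_i(x')$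 and $=x\ddot{\otimes}\ddot{f}_i(x')$ if $\ddot{\varphi}_i(x)\le\ddot{\varepsilon}_i(x')$; $\ddot{\varepsilon}_i(x\ddot{\otimes}x')=\max\{\ddot{\varepsilon}_i(x),\ \ddot{\varepsilon}_i(x')-\langle\mathrm{wt}(x),\alpha_i^\vee\rangle\}$; and $\ddot{\varphi}_i(x\ddot{\otimes}x')=\max\{\ddot{\varphi}_i(x)+\langle\mathrm{wt}(x'),\alpha_i^\vee\rangle,\ \ddot{\varphi}_i(x')\}$; where $x\ddot{\otimes}\bot=\bot\ddot{\otimes}x'=\bot$. Then $Q\ddot{\otimes}Q'$ together with $\mathrm{wt}$, $\ddot{e}_i,\ddot{f}_i,\ddot{\varepsilon}_i,\ddot{\varphi}_i$ ($i\in I$) is a seminormal quasi-crystal of type $\Phi$.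
   Context: Let $V$ be a finite-dimensional real vector space with inner product $\langle\cdot,\cdot\rangle$; for $0\ne\alpha\in V$ put $\alpha^\vee=\frac{2}{\langle\alpha,\alpha\rangle}\alpha$. A root system is a nonempty finite set $\Phi\subseteq V\setminus\{0\}$ such that $\beta-\langle\beta,\alpha^\vee\rangle\alpha\in\Phi$ and $\langle\beta,\alpha^\vee\rangle\in\mathbb{Z}$ for all $\alpha,\beta\in\Phi$, and such that $\alpha,k\alpha\in\Phi$ implies $k=\pm1$. With it one fixes an index set $I$ and simple roots $(\alpha_i)_{i\in I}$ in $\Phi$ (linearly independent, and every root is an integer combination of them with all coefficients $\ge0$ or all $\le0$), and a weight lattice $\Lambda$: a $\mathbb{Z}$-submodule of $V$ spanning $V$, containing $\Phi$, with $\langle\lambda,\alpha^\vee\rangle\in\mathbb{Z}$ for all $\lambda\in\Lambda,\alpha\in\Phi$. Extend $\mathbb{Z}$ by $-\infty<m<+\infty$ with $m+(\pm\infty)=(\pm\infty)+m=\pm\infty$ for $m\in\mathbb{Z}$. A quasi-crystal $\mathcal{Q}$ of type $\Phi$ is a set $Q$ with maps $\mathrm{wt}:Q\to\Lambda$, $\ddot{e}_i,\ddot{f}_i:Q\to Q\sqcup\{\bot\}$ ($\bot$ means ''undefined'') and $\ddot{\varepsilon}_i,\ddot{\varphi}_i:Q\to\mathbb{Z}\cup\{-\infty,+\infty\}$ ($i\in I$) such that for all $x,y\in Q$, $i\in I$: (a) $\ddot{\varphi}_i(x)=\ddot{\varepsilon}_i(x)+\langle\mathrm{wt}(x),\alpha_i^\vee\rangle$;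 (b) if $\ddot{e}_i(x)\in Q$ then $\mathrm{wt}(\ddot{e}_i(x))=\mathrm{wt}(x)+\alpha_i$, $\ddot{\varepsilon}_i(\ddot{e}_i(x))=\ddot{\varepsilon}_i(x)-1$, $\ddot{\varphi}_i(\ddot{e}_i(x))=\ddot{\varphi}_i(x)+1$; (c) if $\ddot{f}_i(x)\in Q$ then $\mathrm{wt}(\ddot{f}_i(x))=\mathrm{wt}(x)-\alpha_i$, $\ddot{\varepsilon}_i(\ddot{f}_i(x))=\ddot{\varepsilon}_i(x)+1$, $\ddot{\varphi}_i(\ddot{f}_i(x))=\ddot{\varphi}_i(x)-1$; (d) $\ddot{e}_i(x)=y$ iff $x=\ddot{f}_i(y)$; (e) if $\ddot{\varepsilon}_i(x)\in\{-\infty,+\infty\}$ then $\ddot{e}_i(x)=\ddot{f}_i(x)=\bot$. Operators are composed as partial maps, with $\ddot{e}_i^0,\ddot{f}_i^0$ the identity. $\mathcal{Q}$ is seminormal if for all $x\in Q$, $i\in I$ with $\ddot{\varepsilon}_i(x)\ne+\infty$: $\ddot{\varepsilon}_i(x)=\max\{k\ge0:\ddot{e}_i^k(x)\in Q\}$ and $\ddot{\varphi}_i(x)=\max\{k\ge0:\ddot{f}_i^k(x)\in Q\}$. *)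

(* Defs.v *)
From HB Require Import structures.
From mathcomp Require Import all_boot all_order all_algebra finmap.
From mathcomp Require Import constructive_ereal reals.

Set Implicit Arguments.
Unset Strict Implicit.
Unset Printing Implicit Defensive.

Import Order.TTheory GRing.Theory Num.Theory.
Local Open Scope ring_scope.

(* {dot V for @idfun R} is the type of symmetric positive definite bilinear
   forms on V, i.e. of inner products on the real vector space V. *)

Definition coroot (R : realType) (V : vectType R) (dot : {dot V for @idfun R})
  (a : V) : V := (2 / dot a a) *: a.

Record is_root_system (R : realType) (V : vectType R)
    (dot : {dot V for @idfun R}) (Phi : {fset V}) : Prop := IsRootSystem {
  roots_nonempty : Phi != fset0;
  roots_neq0 : 0 \notin Phi;
  roots_reflection : forall a b : V, a \in Phi -> b \in Phi ->
    b - dot b (coroot dot a) *: a \in Phi;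
  roots_integral : forall a b : V, a \in Phi -> b \in Phi ->
    dot b (coroot dot a) \is a Num.int;
  roots_reduced : forall (a : V) (k : R), a \in Phi -> k *: a \in Phi ->
    k = 1 \/ k = -1
}.

(* The index set of the simple roots is a finType: a linearly independent
   family in a finite-dimensional space is necessarily finite. *)
Record is_simple_roots (R : realType) (V : vectType R) (Phi : {fset V})
    (I : finType) (alpha : I -> V) : Prop := IsSimpleRoots {
  simple_roots_in : forall i : I, alpha i \in Phi;
  simple_roots_free : free [seq alpha i | i <- enum I];
  simple_roots_gen : forall b : V, b \in Phi ->
    exists c : I -> int, b = \sum_(i : I) alpha i *~ c i /\
      ((forall i : I, 0 <= c i) \/ (forall i : I, c i <= 0))
}.

(* zmodClosed V is the type of additive subgroups (Z-submodules) of V. *)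
Record is_weight_lattice (R : realType) (V : vectType R)
    (dot : {dot V for @idfun R}) (Phi : {fset V}) (Lam : zmodClosed V) : Prop :=
  IsWeightLattice {
  lattice_spans : forall v : V,
    exists2 X : seq V, {subset X <= Lam} & v \in <<X>>%VS;
  lattice_roots : forall a : V, a \in Phi -> a \in Lam;
  lattice_integral : forall l a : V, l \in Lam -> a \in Phi ->
    dot l (coroot dot a) \is a Num.int
}.

(* The integer <l, a^vee>: for l in the weight lattice and a a root the real
   number is integral by lattice_integral, and floor only changes its type. *)
Definition pairing (R : realType) (V : vectType R) (dot : {dot V for @idfun R})
  (l a : V) : int := Num.floor (dot l (coroot dot a)).

(* Z with -oo and +oo is \bar int; None stands for "undefined". *)
Record qcData (R : realType) (V : vectType R) (I : finType) (Q : Type) :=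
  QcData {
  qwt : Q -> V;
  qe : I -> Q -> option Q;
  qf : I -> Q -> option Q;
  qeps : I -> Q -> \bar int;
  qphi : I -> Q -> \bar int
}.

Record is_quasi_crystal (R : realType) (V : vectType R)
    (dot : {dot V for @idfun R}) (I : finType) (alpha : I -> V)
    (Lam : zmodClosed V) (Q : Type) (D : qcData V I Q) : Prop :=
  IsQuasiCrystal {
  qc_wt : forall x : Q, qwt D x \in Lam;
  qc_phi : forall (i : I) (x : Q),
    qphi D i x = (qeps D i x + (pairing dot (qwt D x) (alpha i))%:E)%E;
  qc_e : forall (i : I) (x y : Q), qe D i x = Some y ->
    [/\ qwt D y = qwt D x + alpha i,
        qeps D i y = (qeps D i x - 1%:E)%E
      & qphi D i y = (qphi D i x + 1%:E)%E];
  qc_f : forall (i : I) (x y : Q), qf D i x = Some y ->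
    [/\ qwt D y = qwt D x - alpha i,
        qeps D i y = (qeps D i x + 1%:E)%E
      & qphi D i y = (qphi D i x - 1%:E)%E];
  qc_ef : forall (i : I) (x y : Q), qe D i x = Some y <-> Some x = qf D i y;
  qc_infty : forall (i : I) (x : Q),
    qeps D i x = -oo%E \/ qeps D i x = +oo%E ->
    qe D i x = None /\ qf D i x = None
}.

Definition iter_partial (Q : Type) (g : Q -> option Q) (k : nat) (x : Q) :
  option Q := iter k (obind g) (Some x).

(* m = max {k >= 0 : g^k(x) is defined}, including that the maximum exists. *)
Definition is_max_iter (Q : Type) (g : Q -> option Q) (x : Q) (m : \bar int) :
    Prop :=
  exists k : nat, [/\ m = (k%:Z)%:E, isSome (iter_partial g k x)
    & forall j : nat, isSome (iter_partial g j x) -> (j <= k)%N].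

Definition seminormal (R : realType) (V : vectType R) (I : finType) (Q : Type)
    (D : qcData V I Q) : Prop :=
  forall (x : Q) (i : I), qeps D i x <> +oo%E ->
    is_max_iter (qe D i) x (qeps D i x) /\ is_max_iter (qf D i) x (qphi D i x).

Definition qtensor (R : realType) (V : vectType R) (dot : {dot V for @idfun R})
    (I : finType) (alpha : I -> V) (Q Q' : Type)
    (D : qcData V I Q) (D' : qcData V I Q') : qcData V I (Q * Q') :=
  let blocked (i : I) (p : Q * Q') : bool :=
    (0%:E < qphi D i p.1)%E && (0%:E < qeps D' i p.2)%E in
  let left (p : Q * Q') (u : option Q) : option (Q * Q') :=
    omap (fun y => (y, p.2)) u in
  let right (p : Q * Q') (u : option Q') : option (Q * Q') :=
    omap (fun y' => (p.1, y')) u in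
  {| qwt := fun p => qwt D p.1 + qwt D' p.2;
     qe := fun i p =>
       if blocked i p then None
       else if (qeps D' i p.2 <= qphi D i p.1)%E then left p (qe D i p.1)
       else right p (qe D' i p.2);
     qf := fun i p =>
       if blocked i p then None
       else if (qeps D' i p.2 < qphi D i p.1)%E then left p (qf D i p.1)
       else right p (qf D' i p.2);
     qeps := fun i p =>
       if blocked i p then +oo%E
       else Order.max (qeps D i p.1)
         (qeps D' i p.2 - (pairing dot (qwt D p.1) (alpha i))%:E)%E;
     qphi := fun i p =>
       if blocked i p then +oo%E
       else Order.max
         (qphi D i p.1 + (pairing dot (qwt D' p.2) (alpha i))%:E)%E
         (qphi D' i p.2) |}.

(* Main.v *)
(* In a seminormal quasi-crystal, at each colour i an element x either has
   eps x = phi x = +oo and no operators, or eps x and phi x are naturals that are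
   positive exactly when e x, respectively f x, is defined.  If (x, x') is neither
   blocked nor infinite then phi x = 0 or eps x' = 0, and since
   <wt x, alpha_i^vee> = phi x - eps x the two maxima collapse to the sums
   eps x + eps x' and phi x + phi x'.  Moreover e acts on the first factor iff
   eps x' = 0 and f acts on the second iff phi x = 0.  The condition
   "phi x = 0 or eps x' = 0" survives each step, so the axioms follow factorwise;
   seminormality follows because a finite eps (or phi) drops by one along each
   step and the operator is undefined exactly when it reaches 0. *)
Require Import Defs.
From HB Require Import structures.
From mathcomp Require Import all_boot all_order all_algebra finmap.
From mathcomp Require Import constructive_ereal reals.
From mathcomp Require Import zify.

Local Open Scope ring_scope.
Import Order.TTheory GRing.Theory Num.Theory.
Set Implicit Arguments.
Unset Strict Implicit.

(** Lattice integrality makes [dot l (coroot dot a)] an integer, and the floor is additive once one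
    summand is an integer. *)
Lemma pairingD (R : realType) (V : vectType R) (dot : {dot V for @idfun R})
  (Phi : {fset V}) (Lam : zmodClosed V) (hLam : is_weight_lattice dot Phi Lam)
  (l l' a : V) : l \in Lam -> l' \in Lam -> a \in Phi ->
  pairing dot (l + l') a = pairing dot l a + pairing dot l' a.
Proof.
move=> hl hl' ha; rewrite /pairing linearDl /= floorDzr //.
exact: lattice_integral hLam _ _ hl ha.
Qed.

(** * Iterates of partial maps and their lengths *)

Lemma iter_partialS (Q : Type) (g : Q -> option Q) (k : nat) (x : Q) :
  iter_partial g k.+1 x = if g x is Some y then iter_partial g k y else None.
Proof.
rewrite /iter_partial iterSr /=; case: (g x) => [//|].
(* An undefined first step stays undefined under all further iterates. *)
by elim: k => //= k ->.
Qed.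

Lemma is_max_iter_step (Q : Type) (g : Q -> option Q) (x : Q) (m : \bar int) :
  is_max_iter g x m ->
  exists n : nat, m = (n%:Z)%:E /\ isSome (g x) = (0 < n)%N.
Proof.
move=> [n [-> def_n max_n]]; exists n; split=> //.
case: n def_n max_n => [|n].
  by move=> _ /(_ 1%N); rewrite iter_partialS; case: (g x) => // y /(_ isT).
by rewrite iter_partialS; case: (g x).
Qed.

(** Converse of [is_max_iter_step]: a counter that drops by one along [g] and vanishes exactly where
    [g] stops counts the remaining steps. Induction on the value of [m]. *)
Lemma is_max_iter_descent (Q : Type) (g : Q -> option Q) (m : Q -> \bar int) :
  (forall x, m x <> +oo%E ->
    exists n : nat, m x = (n%:Z)%:E /\ isSome (g x) = (0 < n)%N) ->
  (forall x y, g x = Some y -> m y = (m x - 1%:E)%E) ->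
  forall x, m x <> +oo%E -> is_max_iter g x (m x).
Proof.
move=> m_nat m_step x /[dup] /m_nat[n [mx _]] mx_fin.
elim: n x mx mx_fin => [|n IHn] x mx /[dup] mx_fin /m_nat[k [mk def_g]].
  move: mk def_g; rewrite mx => -[<-] /= gx.
  exists 0%N; split=> // -[|j] //.
  by rewrite iter_partialS; case: (g x) gx.
move: mk def_g; rewrite mx => -[<-] /=.
case gx: (g x) => [y|] // _.
have my : m y = (n%:Z)%:E.
  by rewrite (m_step _ _ gx) mx -EFinB; congr EFin; lia.
have [|k' [my' def_k max_k]] := IHn y my; first by rewrite my.
move: my'; rewrite my => -[n_k].
exists n.+1; split=> //; rewrite ?iter_partialS ?gx ?n_k //.
by move=> [|j] //; rewrite iter_partialS gx ltnS => /max_k.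
Qed.

(** * Finite and infinite values in the tensor product *)

Lemma seminormal_cases (R : realType) (V : vectType R)
  (dot : {dot V for @idfun R}) (I : finType) (alpha : I -> V)
  (Lam : zmodClosed V) (Q : Type) (D : qcData V I Q)
  (hD : is_quasi_crystal dot alpha Lam D) (sD : seminormal D) (i : I) (x : Q) :
  [/\ qeps D i x = +oo%E, qphi D i x = +oo%E, qe D i x = None
    & qf D i x = None] \/
  exists a b : nat, [/\ qeps D i x = (a%:Z)%:E, qphi D i x = (b%:Z)%:E,
    isSome (qe D i x) = (0 < a)%N & isSome (qf D i x) = (0 < b)%N].
Proof.
have [eps_oo|/eqP/(sD x i)[he hf]] := eqVneq (qeps D i x) +oo%E.
  left; have [|-> ->] := qc_infty hD (i := i) (x := x); first by right.
  by rewrite (qc_phi hD) eps_oo.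
(* Seminormality excludes the value -oo as well. *)
right; have [a [-> ->]] := is_max_iter_step he.
by have [b [-> ->]] := is_max_iter_step hf; exists a, b.
Qed.

Lemma qtensor_finite (R : realType) (V : vectType R)
  (dot : {dot V for @idfun R}) (I : finType) (alpha : I -> V)
  (Lam : zmodClosed V) (Q Q' : Type) (D : qcData V I Q) (D' : qcData V I Q')
  (hD : is_quasi_crystal dot alpha Lam D)
  (hD' : is_quasi_crystal dot alpha Lam D') (i : I) (x : Q) (x' : Q')
  (a b a' b' : nat) (T := qtensor dot alpha D D') :
  qeps D i x = (a%:Z)%:E -> qphi D i x = (b%:Z)%:E ->
  qeps D' i x' = (a'%:Z)%:E -> qphi D' i x' = (b'%:Z)%:E ->
  (b == 0)%N || (a' == 0)%N ->
  [/\ qeps T i (x, x') = ((a + a')%N%:Z)%:E,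
      qphi T i (x, x') = ((b + b')%N%:Z)%:E,
      qe T i (x, x') = (if (a' == 0)%N then omap (fun y => (y, x')) (qe D i x)
                        else omap (fun y' => (x, y')) (qe D' i x'))
    & qf T i (x, x') = (if (b == 0)%N then omap (fun y' => (x, y')) (qf D' i x')
                        else omap (fun y => (y, x')) (qf D i x))].
Proof.
move=> ea eb ea' eb' unblocked.
(* These equations turn the two pairings into b - a and b' - a', so that the maxima become integer
   arithmetic. *)
have := qc_phi hD i x; have := qc_phi hD' i x'.
rewrite ea eb ea' eb' -!EFinD => -[p'E] [pE].
rewrite /T /qtensor /= ea eb ea' eb' -!EFinD -!EFin_max !lte_fin !lee_fin.
have -> : ((0 < b%:Z) && (0 < a'%:Z)) = false by lia.
split.
- by congr EFin; lia.
- by congr EFin; lia.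
(* As b or a' vanishes, comparing them only tests whether a' = 0; likewise for b below. *)
- by have -> : (a'%:Z <= b%:Z) = (a' == 0)%N by lia.
- have -> : (a'%:Z < b%:Z) = ~~ (b == 0)%N by lia.
  by case: (b == 0)%N.
Qed.

(** If a factor is infinite, either the pair is blocked, or the maxima are +oo and the comparison
    selects that factor, whose operators are undefined. *)
Lemma qtensor_cases (R : realType) (V : vectType R)
  (dot : {dot V for @idfun R}) (I : finType) (alpha : I -> V)
  (Lam : zmodClosed V) (Q Q' : Type) (D : qcData V I Q) (D' : qcData V I Q')
  (hD : is_quasi_crystal dot alpha Lam D) (sD : seminormal D)
  (hD' : is_quasi_crystal dot alpha Lam D') (sD' : seminormal D')
  (i : I) (x : Q) (x' : Q') (T := qtensor dot alpha D D') :
  [/\ qeps T i (x, x') = +oo%E, qphi T i (x, x') = +oo%E,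
      qe T i (x, x') = None & qf T i (x, x') = None] \/
  exists a b a' b' : nat,
    [/\ qeps D i x = (a%:Z)%:E, qphi D i x = (b%:Z)%:E,
        qeps D' i x' = (a'%:Z)%:E, qphi D' i x' = (b'%:Z)%:E
      & (b == 0)%N || (a' == 0)%N].
Proof.
have [[ea eb ne nf]|[a [b [ea eb _ _]]]] := seminormal_cases hD sD i x;
  have [[ea' eb' ne' nf']|[a' [b' [ea' eb' _ _]]]] := seminormal_cases hD' sD' i x'.
- by left; rewrite /T /qtensor /= eb ea' /=.
- left; rewrite /T /qtensor /= ea eb ea' eb' ne nf /=.
  by case: ifP => // _; split; rewrite ?maxye ?maxey.
- left; rewrite /T /qtensor /= ea eb ea' eb' ne' nf' /=.
  by case: ifP => // _; split; rewrite ?maxye ?maxey.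
have [unblocked|blocked] := boolP ((b == 0)%N || (a' == 0)%N).
  by right; exists a, b, a', b'.
left; rewrite /T /qtensor /= eb ea' !lte_fin.
by have -> : (0 < b%:Z) && (0 < a'%:Z) by lia.
Qed.

(** * Effect of one raising or lowering step *)

Lemma qe_step (R : realType) (V : vectType R)
  (dot : {dot V for @idfun R}) (I : finType) (alpha : I -> V)
  (Lam : zmodClosed V) (Q : Type) (D : qcData V I Q)
  (hD : is_quasi_crystal dot alpha Lam D) (sD : seminormal D)
  (i : I) (x y : Q) (a b : nat) :
  qeps D i x = (a%:Z)%:E -> qphi D i x = (b%:Z)%:E -> qe D i x = Some y ->
  [/\ (0 < a)%N, qeps D i y = (a.-1%:Z)%:E & qphi D i y = (b.+1%:Z)%:E].
Proof.
move=> ea eb gx; have [_ -> ->] := qc_e hD gx.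
(* Since [qe] is defined at x, seminormality gives a > 0, so [a.-1] is a true predecessor. *)
have [[ea']|[a' [b' [ea' eb' edef fdef]]]] := seminormal_cases hD sD i x.
  by rewrite ea in ea'.
rewrite ?gx ea eb in ea' eb' edef fdef *.
case: ea' eb' edef fdef => <- [<-] /= edef fdef.
by split; [lia | rewrite -?EFinB -?EFinD; congr EFin; lia ..].
Qed.

Lemma qf_step (R : realType) (V : vectType R)
  (dot : {dot V for @idfun R}) (I : finType) (alpha : I -> V)
  (Lam : zmodClosed V) (Q : Type) (D : qcData V I Q)
  (hD : is_quasi_crystal dot alpha Lam D) (sD : seminormal D)
  (i : I) (x y : Q) (a b : nat) :
  qeps D i x = (a%:Z)%:E -> qphi D i x = (b%:Z)%:E -> qf D i x = Some y ->
  [/\ (0 < b)%N, qeps D i y = (a.+1%:Z)%:E & qphi D i y = (b.-1%:Z)%:E].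
Proof.
move=> ea eb gx; have [_ -> ->] := qc_f hD gx.
have [[ea']|[a' [b' [ea' eb' edef fdef]]]] := seminormal_cases hD sD i x.
  by rewrite ea in ea'.
rewrite ?gx ea eb in ea' eb' edef fdef *.
case: ea' eb' edef fdef => <- [<-] /= edef fdef.
by split; [lia | rewrite -?EFinB -?EFinD; congr EFin; lia ..].
Qed.

(** The step keeps the pair unblocked: it leaves a' = 0 fixed, or lowers a' while b = 0. Hence [qf]
    then picks the same factor and undoes the step. *)
Lemma qtensor_qe_step (R : realType) (V : vectType R)
  (dot : {dot V for @idfun R}) (I : finType) (alpha : I -> V)
  (Lam : zmodClosed V) (Q Q' : Type) (D : qcData V I Q) (D' : qcData V I Q')
  (hD : is_quasi_crystal dot alpha Lam D) (sD : seminormal D)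
  (hD' : is_quasi_crystal dot alpha Lam D') (sD' : seminormal D')
  (i : I) (p q : Q * Q') (T := qtensor dot alpha D D') :
  qe T i p = Some q ->
  [/\ qwt T q = qwt T p + alpha i, qeps T i q = (qeps T i p - 1%:E)%E,
      qphi T i q = (qphi T i p + 1%:E)%E & qf T i q = Some p].
Proof.
case: p => x x'.
have [[_ _ ne nf]|[a [b [a' [b' [ea eb ea' eb' unblocked]]]]]] :=
  qtensor_cases hD sD hD' sD' i x x'.
  by rewrite /T ne.
have [-> -> Te Tf] := qtensor_finite hD hD' ea eb ea' eb' unblocked.
rewrite Te; case: ifPn => test.
  case gx: (qe D i x) => [y|] // -[<-].
  have [wy _ _] := qc_e hD gx.
  have [pos ey fy] := qe_step hD sD ea eb gx.
  have [|-> -> Ue Uf] := qtensor_finite hD hD' ey fy ea' eb'; first by lia.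
  split; [|by rewrite -?EFinB -?EFinD; congr EFin; lia ..|].
    by rewrite /= wy addrAC.
  have /esym gy := (qc_ef hD i x y).1 gx.
  (* The new [qphi] of the first factor is [b.+1], so [qf] acts there. *)
  by rewrite Uf gy.
case gx: (qe D' i x') => [y'|] // -[<-].
have [wy _ _] := qc_e hD' gx.
have [pos ey fy] := qe_step hD' sD' ea' eb' gx.
have [|-> -> Ue Uf] := qtensor_finite hD hD' ea eb ey fy; first by lia.
split; [|by rewrite -?EFinB -?EFinD; congr EFin; lia ..|].
  by rewrite /= wy addrA.
have /esym gy := (qc_ef hD' i x' y').1 gx.
(* Here a' is nonzero, hence b = 0 and [qf] acts on the second factor. *)
by rewrite Uf gy ifT //; lia.
Qed.

Lemma qtensor_qf_step (R : realType) (V : vectType R)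
  (dot : {dot V for @idfun R}) (I : finType) (alpha : I -> V)
  (Lam : zmodClosed V) (Q Q' : Type) (D : qcData V I Q) (D' : qcData V I Q')
  (hD : is_quasi_crystal dot alpha Lam D) (sD : seminormal D)
  (hD' : is_quasi_crystal dot alpha Lam D') (sD' : seminormal D')
  (i : I) (p q : Q * Q') (T := qtensor dot alpha D D') :
  qf T i p = Some q ->
  [/\ qwt T q = qwt T p - alpha i, qeps T i q = (qeps T i p + 1%:E)%E,
      qphi T i q = (qphi T i p - 1%:E)%E & qe T i q = Some p].
Proof.
case: p => x x'.
have [[_ _ ne nf]|[a [b [a' [b' [ea eb ea' eb' unblocked]]]]]] :=
  qtensor_cases hD sD hD' sD' i x x'.
  by rewrite /T nf.
have [-> -> Te Tf] := qtensor_finite hD hD' ea eb ea' eb' unblocked.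
rewrite Tf; case: ifPn => test.
  case gx: (qf D' i x') => [y'|] // -[<-].
  have [wy _ _] := qc_f hD' gx.
  have [pos ey fy] := qf_step hD' sD' ea' eb' gx.
  have [|-> -> Ue Uf] := qtensor_finite hD hD' ea eb ey fy; first by lia.
  split; [|by rewrite -?EFinB -?EFinD; congr EFin; lia ..|].
    by rewrite /= wy addrA.
  have gy := (qc_ef hD' i y' x').2 (esym gx).
  by rewrite Ue gy.
case gx: (qf D i x) => [y|] // -[<-].
have [wy _ _] := qc_f hD gx.
have [pos ey fy] := qf_step hD sD ea eb gx.
have [|-> -> Ue Uf] := qtensor_finite hD hD' ey fy ea' eb'; first by lia.
split; [|by rewrite -?EFinB -?EFinD; congr EFin; lia ..|].
  by rewrite /= wy addrAC.
have gy := (qc_ef hD i y x).2 (esym gx).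
(* Here b is nonzero, hence a' = 0 and [qe] acts on the first factor. *)
by rewrite Ue gy ifT //; lia.
Qed.

(** * Seminormality and the axioms for the tensor product *)

(** Supplies the local criterion for [is_max_iter_descent]. If a' = 0, then [qe] is governed by a =
    a + a'; otherwise the second factor moves and both a' and a + a' are positive. Dually for
    [qf]. *)
Lemma qtensor_string_lengths (R : realType) (V : vectType R)
  (dot : {dot V for @idfun R}) (I : finType) (alpha : I -> V)
  (Lam : zmodClosed V) (Q Q' : Type) (D : qcData V I Q) (D' : qcData V I Q')
  (hD : is_quasi_crystal dot alpha Lam D) (sD : seminormal D)
  (hD' : is_quasi_crystal dot alpha Lam D') (sD' : seminormal D')
  (i : I) (x : Q) (x' : Q') (T := qtensor dot alpha D D') :
  [/\ qeps T i (x, x') = +oo%E, qphi T i (x, x') = +oo%E,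
      qe T i (x, x') = None & qf T i (x, x') = None] \/
  exists a b : nat,
    [/\ qeps T i (x, x') = (a%:Z)%:E, qphi T i (x, x') = (b%:Z)%:E,
        isSome (qe T i (x, x')) = (0 < a)%N
      & isSome (qf T i (x, x')) = (0 < b)%N].
Proof.
have [?|[a [b [a' [b' [ea eb ea' eb' unblocked]]]]]] :=
  qtensor_cases hD sD hD' sD' i x x'; [by left | right].
have [-> -> -> ->] := qtensor_finite hD hD' ea eb ea' eb' unblocked.
have [[e1]|[c [d [e1 f1 de df]]]] := seminormal_cases hD sD i x.
  by rewrite ea in e1.
have [[e2]|[c' [d' [e2 f2 de' df']]]] := seminormal_cases hD' sD' i x'.
  by rewrite ea' in e2.
rewrite ea eb ea' eb' in e1 f1 e2 f2.
case: e1 f1 e2 f2 de df de' df' => <- [<-] [<-] [<-] de df de' df'.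
exists (a + a')%N, (b + b')%N; split=> //.
- case: ifPn => test; first by case: (qe D i x) de => //= *; lia.
  by case: (qe D' i x') de' => //= *; lia.
- case: ifPn => test; first by case: (qf D' i x') df' => //= *; lia.
  by case: (qf D i x) df => //= *; lia.
Qed.

Unset Implicit Arguments.

Theorem theorem5p1 (R : realType) (V : vectType R) (dot : {dot V for @idfun R})
  (Phi : {fset V}) (hPhi : is_root_system dot Phi)
  (I : finType) (alpha : I -> V) (halpha : is_simple_roots Phi alpha)
  (Lam : zmodClosed V) (hLam : is_weight_lattice dot Phi Lam)
  (Q Q' : Type) (D : qcData V I Q) (D' : qcData V I Q')
  (hD : is_quasi_crystal dot alpha Lam D) (sD : seminormal D)
  (hD' : is_quasi_crystal dot alpha Lam D') (sD' : seminormal D') :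
  is_quasi_crystal dot alpha Lam (qtensor dot alpha D D') /\
  seminormal (qtensor dot alpha D D').
Proof.
split.
  split.
  - by move=> p /=; rewrite rpredD ?(qc_wt hD) ?(qc_wt hD').
  - move=> i [x x'].
    have [[-> ->]|[a [b [a' [b' [ea eb ea' eb' unblocked]]]]]] :=
      qtensor_cases hD sD hD' sD' i x x'; first by [].
    have [-> -> _ _] := qtensor_finite hD hD' ea eb ea' eb' unblocked.
    rewrite /= (pairingD hLam) ?(qc_wt hD) ?(qc_wt hD') ?(simple_roots_in halpha) //.
    have := qc_phi hD i x; have := qc_phi hD' i x'.
    rewrite ea eb ea' eb' -!EFinD => -[p'E] [pE].
    by congr EFin; lia.
  - by move=> i p q /(qtensor_qe_step hD sD hD' sD')[].
  - by move=> i p q /(qtensor_qf_step hD sD hD' sD')[].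
  (* Each step lemma provides one direction of the inverse relation. *)
  - move=> i p q; split.
      by move=> /(qtensor_qe_step hD sD hD' sD')[].
    by move=> /esym /(qtensor_qf_step hD sD hD' sD')[].
  - move=> i [x x'].
    have [[_ _ -> ->] //|[a [b [a' [b' [ea eb ea' eb' unblocked]]]]]] :=
      qtensor_cases hD sD hD' sD' i x x'.
    by have [-> _ _ _] := qtensor_finite hD hD' ea eb ea' eb' unblocked; case.
move=> [x x'] i eps_fin; split.
  apply: is_max_iter_descent eps_fin => [[y y']|p q /(qtensor_qe_step hD sD hD' sD')[] //].
  have [[-> //]|[a [b [-> _ -> _]]]] := qtensor_string_lengths hD sD hD' sD' i y y'.
  by exists a.
apply: is_max_iter_descent => [[y y']|p q /(qtensor_qf_step hD sD hD' sD')[] //|].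
  have [[_ -> //]|[a [b [_ -> _ ->]]]] := qtensor_string_lengths hD sD hD' sD' i y y'.
  by exists b.
(* Finiteness is assumed for [qeps] only; it excludes the infinite alternative, so [qphi] is finite
   too. *)
by have [[]|[a [b [_ ->]]]] := qtensor_string_lengths hD sD hD' sD' i x x'.
Qed.
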